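(* Let $\mathcal{G}=(\mathcal{V},\mathcal{E},A)$ be a strongly connected signed digraph on $n$ nodes, and let $\hat{L}$ be the Laplacian matrix of its mirror signed graph $\hat{\mathcal{G}}$. Consider the system $$\dot{x}(t)=-\hat{L}x(t),\qquad x(t)\in\mathbb{R}^n .$$ Then this system achieves 1) signed-average consensus if and only if $\mathcal{G}$ is structurally balanced; 2) state stability if and only if $\mathcal{G}$ is structurally unbalanced.
   Context: Write $\mathcal{F}_n=\{1,\dots,n\}$. A signed digraph $\mathcal{G}=(\mathcal{V},\mathcal{E},A)$ has node set $\mathcal{V}=\{v_1,\dots,v_n\}$, edge set $\mathcal{E}\subseteq\mathcal{V}\times\mathcal{V}$, and real weight matrix $A=[a_{ij}]\in\mathbb{R}^{n\times n}$ with $a_{ij}\neq0\Leftrightarrow(v_j,v_i)\in\mathcal{E}$. Standing assumptions: no self-loops ($a_{ii}=0$ for all $i$) and digon sign-symmetry ($a_{ij}a_{ji}\ge0$ for all $i,j$). $\mathcal{G}$ is strongly connected if there is a directed path between every ordered pair of distinct nodes. $\mathcal{G}$ is structurally balanced if $\mathcal{V}$ is the union of two disjoint subsets $\mathcal{V}_1,\mathcal{V}_2$ (either may be empty) with $a_{ij}\ge0$ whenever $v_i,v_j$ lie in the same subset and $a_{ij}\le0$ whenever they lie in different subsets; otherwise $\mathcal{G}$ is structurally unbalanced. Induced unsigned digraph: $\overline{\mathcal{G}}=(\mathcal{V},\mathcal{E},\overline{A})$ with $\overline{A}=[|a_{ij}|]$; its Laplacian is $\overline{L}=\Delta-\overline{A}$,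 where $\Delta=\mathrm{diag}\{\sum_{j=1}^n|a_{1j}|,\dots,\sum_{j=1}^n|a_{nj}|\}$. $\overline{L}_{ii}\in\mathbb{R}^{(n-1)\times(n-1)}$ denotes $\overline{L}$ with its $i$th row and $i$th column removed. Mirror signed graph: $\hat{\mathcal{G}}$ is the undirected signed graph on $\mathcal{V}$ with symmetric weight matrix $\hat{A}=[\hat{a}_{ij}]$, $\hat{a}_{ij}=\frac{1}{2}\left(\det(\overline{L}_{ii})a_{ij}+\det(\overline{L}_{jj})a_{ji}\right)$. Its Laplacian is $\hat{L}=\hat{\Delta}-\hat{A}$ with $\hat{\Delta}=\mathrm{diag}\{\sum_{j}|\hat{a}_{1j}|,\dots,\sum_j|\hat{a}_{nj}|\}$. A system with state $x(t)=[x_1(t),\dots,x_n(t)]^T$ achieves signed-average consensus if for every initial state $x(0)=[x_{10},\dots,x_{n0}]^T\in\mathbb{R}^n$ there exist $\sigma_1,\dots,\sigma_n\in\{\pm1\}$ such that $\lim_{t\to\infty}x_i(t)=\frac{\sigma_i}{n}\sum_{j=1}^n\sigma_jx_{j0}$ for all $i\in\mathcal{F}_n$. It achieves state stability if for every initial state $\lim_{t\to\infty}x_i(t)=0$ for all $i\in\mathcal{F}_n$. *)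

(* Defs.v *)
From HB Require Import structures.
From mathcomp Require Import all_boot all_order all_algebra.
From mathcomp Require Import all_classical all_reals all_analysis.

Set Implicit Arguments.
Unset Strict Implicit.
Unset Printing Implicit Defensive.

Import Order.TTheory GRing.Theory Num.Theory.
Import numFieldNormedType.Exports.

Local Open Scope ring_scope.

(* The node v_i is the ordinal i. The edge set is not a field because the
   weight matrix determines it. *)
Record signed_digraph (R : realType) (n : nat) := SignedDigraph {
  weight : 'M[R]_n;
  no_self_loops : forall i, weight i i = 0;
  digon_sign_symmetry : forall i j, 0 <= weight i j * weight j i }.

(* [edge G j i] is the edge from v_j to v_i, carried by the entry (i, j). *)
Definition edge (R : realType) (n : nat) (G : signed_digraph R n) : rel 'I_n :=
  [rel j i | weight G i j != 0].

Definition strongly_connected (R : realType) (n : nat)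
    (G : signed_digraph R n) : Prop :=
  forall i j : 'I_n, i != j -> connect (edge G) i j.

Definition structurally_balanced (R : realType) (n : nat)
    (G : signed_digraph R n) : Prop :=
  exists V1 V2 : {set 'I_n},
    [/\ (V1 :|: V2)%SET = [set: 'I_n]%SET,
        [disjoint V1 & V2],
        forall i j, (i \in V1) && (j \in V1) || (i \in V2) && (j \in V2) ->
          0 <= weight G i j
      & forall i j, (i \in V1) && (j \in V2) || (i \in V2) && (j \in V1) ->
          weight G i j <= 0].

Definition structurally_unbalanced (R : realType) (n : nat)
    (G : signed_digraph R n) : Prop :=
  ~ structurally_balanced G.

Definition abs_degree_mx (R : realType) (n : nat) (A : 'M[R]_n) : 'M[R]_n :=
  diag_mx (\row_i \sum_j `|A i j|).

Definition unsigned_weight (R : realType) (n : nat)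
    (G : signed_digraph R n) : 'M[R]_n :=
  \matrix_(i, j) `|weight G i j|.

Definition unsigned_laplacian (R : realType) (n : nat)
    (G : signed_digraph R n) : 'M[R]_n :=
  abs_degree_mx (weight G) - unsigned_weight G.

Definition principal_minor (R : realType) (n : nat) (M : 'M[R]_n)
    (i : 'I_n) : R :=
  \det (row' i (col' i M)).

Definition mirror_weight (R : realType) (n : nat)
    (G : signed_digraph R n) : 'M[R]_n :=
  \matrix_(i, j)
    (2^-1 * (principal_minor (unsigned_laplacian G) i * weight G i j
           + principal_minor (unsigned_laplacian G) j * weight G j i)).

Definition mirror_laplacian (R : realType) (n : nat)
    (G : signed_digraph R n) : 'M[R]_n :=
  abs_degree_mx (mirror_weight G) - mirror_weight G.

Local Open Scope classical_set_scope.

(* x solves x' = M x on [0, +oo[, componentwise: continuous there (one-sided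
   at 0) and differentiable on ]0, +oo[. Values at negative times are
   irrelevant. *)
Definition trajectory (R : realType) (n : nat) (M : 'M[R]_n)
    (x : R -> 'cV[R]_n) : Prop :=
  forall i : 'I_n,
    {within `[0, +oo[, continuous (fun t => x t i ord0)} /\
    forall t : R, 0 < t ->
      is_derive t 1 (fun s => x s i ord0) ((M *m x t) i ord0).

(* The two notions below concern the system x' = M x. Its trajectory from a
   given initial state exists and is unique, M being constant. *)
Definition signed_average_consensus (R : realType) (n : nat)
    (M : 'M[R]_n) : Prop :=
  forall x0 : 'cV[R]_n,
  exists sigma : 'I_n -> R,
    (forall i, sigma i = 1 \/ sigma i = -1) /\
    forall x : R -> 'cV[R]_n, trajectory M x -> x 0 = x0 ->
      forall i, x t i ord0 @[t --> +oo] -->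
        sigma i / n%:R * \sum_j sigma j * x0 j ord0.

Definition state_stability (R : realType) (n : nat) (M : 'M[R]_n) : Prop :=
  forall x0 : 'cV[R]_n,
  forall x : R -> 'cV[R]_n, trajectory M x -> x 0 = x0 ->
    forall i, x t i ord0 @[t --> +oo] --> (0 : R).

(* Main.v *)
(* The principal minors of the unsigned Laplacian are positive, so the mirror
   weights are nonzero wherever G has an edge and carry the signs of G.  The
   form x^T L x of the mirror Laplacian is half the sum over i and j of
   |w_ij| (x_i - sgn(w_ij) x_j)^2, w_ij the mirror weights; by connectivity a nonzero zero of it has
   entries of constant modulus, whose signs balance G.  If G is unbalanced, L is
   thus positive definite and the system is stable.  If G is balanced by signs s,
   the kernel of L is spanned by s, the product s^T x is conserved, and the
   component of x orthogonal to s decays.  For the converses, s is a constant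
   trajectory in the balanced case; in the unbalanced one, some trajectory starts
   at a basis vector, whose signed average is nonzero for every choice of
   signs. *)
Require Import Defs.
From mathcomp Require Import all_boot all_order all_algebra.
From mathcomp Require Import all_classical all_reals all_analysis.
From mathcomp Require Import ring.
Import Order.TTheory GRing.Theory Num.Theory.
Import numFieldNormedType.Exports.
Local Open Scope ring_scope.

Set Implicit Arguments.
Unset Strict Implicit.
Unset Printing Implicit Defensive.

(** * Strong connectivity and positivity of the principal minors *)

(** Strong connectivity enters through this lemma: a property passed from the head to the tail of
    each edge spreads from one node to all. *)
Lemma connect_pullback (T : finType) (e : rel T) (P : T -> Prop) (x y : T) :
  (forall u v, e u v -> P v -> P u) -> connect e x y -> P y -> P x.
Proof.
move=> eP /connectP[p]; elim: p x => [|z p IHp] x /=; first by move=> _ ->.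
by move=> /andP[xz zp] lp Py; apply: eP xz _; exact: IHp zp lp Py.
Qed.

(* Maximum principle: the maximum of [w] propagates backwards along edges
   until it reaches [i0]. *)
Lemma subharmonic_eq0 (R : realType) n (G : signed_digraph R n) (i0 : 'I_n)
    (w : 'I_n -> R) :
  strongly_connected G -> (forall i, 0 <= w i) -> w i0 = 0 ->
  (forall i, i != i0 -> (\sum_j `|weight G i j|) * w i
                        <= \sum_j `|weight G i j| * w j) ->
  forall i, w i = 0.
Proof.
move=> Gc w_ge0 wi0 sub.
have [m _ wmP] := arg_maxP w (erefl (xpredT i0)).
have wm i : w i <= w m by exact: wmP.
suff wm0 : w m = 0.
  by move=> i; apply/le_anti/andP; split=> //; rewrite -wm0; exact: wm.
have [->//|mi0] := eqVneq m i0; rewrite -wi0; apply/esym.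
apply: (@connect_pullback _ (edge G) (fun i => w i = w m) i0 m) => //.
  move=> u v /= auv wv.
  have [vi0|vi0] := eqVneq v i0.
    by apply/le_anti/andP; split; [exact: wm | rewrite -wv vi0 wi0].
  have := sub v vi0; rewrite mulr_suml -subr_ge0 -sumrB.
  under eq_bigr do rewrite -mulrBr wv.
  move=> s_ge0.
  (* Every summand is nonpositive because [w m] is maximal, yet the sum is nonnegative, so each
     summand vanishes. *)
  have /(_ u isT)/eqP : forall j, true -> `|weight G v j| * (w j - w m) = 0.
    move=> j _; apply/eqP; rewrite -oppr_eq0; apply/eqP; move: j isT.
    apply: psumr_eq0P => [j _|].
      by rewrite -mulrN mulr_ge0// opprB subr_ge0 wm.
    apply/le_anti/andP; split; first by rewrite sumrN oppr_le0.
    by apply: sumr_ge0 => j _; rewrite -mulrN mulr_ge0// opprB subr_ge0 wm.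
  by rewrite mulf_eq0 normr_eq0 (negbTE auv) subr_eq0 => /eqP.
by apply: Gc; rewrite eq_sym.
Qed.

(* Homotopy to the identity matrix: [(1 - s) I + s B] stays invertible on
   [[0, 1]], so the determinant keeps the sign it has at [s = 0]. *)
Lemma principal_minor_gt0 (R : realType) n (G : signed_digraph R n) i :
  strongly_connected G -> 0 < principal_minor (unsigned_laplacian G) i.
Proof.
move=> Gc; rewrite /principal_minor.
set B := row' _ _.
have detB s : 0 < s -> s <= 1 -> \det ((1 - s)%:M + s *: B) != 0.
  move=> s_gt0 s_le1; apply/negP; rewrite -det_tr => /det0P[v /negP v_neq0 vB].
  apply: v_neq0; apply/eqP/rowP => k; rewrite mxE.
  (* The moduli of the kernel vector, extended by 0 at the removed node, are fed to the maximum
     principle. *)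
  pose w l := if unlift i l is Some l' then `|v ord0 l'| else 0.
  have wl l : w (lift i l) = `|v ord0 l| by rewrite /w liftK.
  have w0 : w i = 0 by rewrite /w unlift_none.
  suff /(_ (lift i k))/eqP : forall l, w l = 0 by rewrite wl normr_eq0 => /eqP.
  apply: (@subharmonic_eq0 R n G i) => //.
    by move=> l; rewrite /w; case: unliftP.
  move=> l il; have [l' ->|lE] := unliftP i l; last by rewrite lE eqxx in il.
  rewrite wl [leRHS](bigD1_ord i)//= w0 mulr0 add0r.
  under [leRHS]eq_bigr do rewrite wl.
  set D := \sum_j _.
  have /rowP/(_ l') := vB; rewrite !mxE => vBl.
  (* Row [l'] of the kernel equation, with degrees and weights on opposite sides; [D] is the full
     degree, which counts the weight from the removed node too. *)
  have E : ((1 - s) + s * D) * v ord0 l'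
      = s * \sum_j `|weight G (lift i l') (lift i j)| * v ord0 j.
    apply/eqP; rewrite -subr_eq0 -[X in _ == X]vBl; apply/eqP.
    transitivity (\sum_j (((1 - s) + s * D) * (v ord0 j *+ (l' == j))
       - s * (`|weight G (lift i l') (lift i j)| * v ord0 j))).
      rewrite sumrB -!mulr_sumr; congr (_ * _ - _).
      rewrite (bigD1 l')//= eqxx mulr1n big1 ?addr0// => j.
      by rewrite eq_sym => /negbTE ->; rewrite mulr0n.
    apply: eq_bigr => j _; rewrite !mxE -/D.
    rewrite (inj_eq lift_inj).
    by case: (l' == j); rewrite ?mulr1n ?mulr0n; ring.
  have Dge0 : 0 <= D by apply: sumr_ge0.
  have : `|((1 - s) + s * D) * v ord0 l'|
      <= s * \sum_j `|weight G (lift i l') (lift i j)| * `|v ord0 j|.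
    rewrite E normrM gtr0_norm// (ler_wpM2l (ltW s_gt0))//.
    apply: le_trans (ler_norm_sum _ _ _) _; apply: ler_sum => j _.
    by rewrite normrM normr_id.
  have s1 : 0 <= 1 - s by rewrite subr_ge0.
  rewrite normrM ger0_norm; last by rewrite addr_ge0// mulr_ge0// ltW.
  (* Dropping [1 - s] only shrinks the left side, and cancelling [s > 0] leaves the subharmonic
     inequality. *)
  move=> vle; rewrite -(ler_pM2l s_gt0); apply: le_trans vle.
  by rewrite mulrA ler_wpM2r// lerDr.
move: B detB => B detB.
(* As a polynomial in [s], the determinant obeys the intermediate value theorem; it is 1 at 0, so a
   nonpositive value at 1 would force a root. *)
pose p : {poly R} := \det ((1 - 'X)%:M + 'X *: map_mx polyC B).
have pE s : p.[s] = \det ((1 - s)%:M + s *: B).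
  rewrite /p -/(horner_eval s _) -det_map_mx; congr (\det _).
  apply/matrixP => j k; rewrite !mxE /= /horner_eval.
  by case: (_ == _); rewrite ?mulr1n ?mulr0n !hornerE.
have pE1 : p.[1] = \det B by rewrite pE subrr scale1r raddf0 add0r.
rewrite -pE1 ltNge; apply/negP => p1.
have [||s /andP[s_ge0 s_le1] /rootP] := @poly_ivt R (- p) 0 1 => //.
  rewrite !hornerN !oppr_cp0 p1 pE subr0 scale0r addr0 det1.
  by rewrite ler01.
rewrite hornerN => /eqP; rewrite oppr_eq0; apply/negP.
have [s0|s_neq0] := eqVneq s 0.
  by rewrite s0 pE subr0 scale0r addr0 det1 oner_eq0.
by rewrite pE detB// lt_neqAle eq_sym s_neq0.
Qed.

(** * Positive definite bilinear forms *)

Definition bform (R : realType) n (P : 'M[R]_n) (x y : 'cV[R]_n) : R :=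
  (x^T *m P *m y) ord0 ord0.

Lemma bformE (R : realType) n (P : 'M[R]_n) x y :
  bform P x y = \sum_i x i ord0 * (P *m y) i ord0.
Proof. by rewrite /bform -mulmxA mxE; apply: eq_bigr => i _; rewrite mxE. Qed.

Lemma bformC (R : realType) n (P : 'M[R]_n) x y :
  P^T = P -> bform P x y = bform P y x.
Proof.
move=> PT; transitivity ((y^T *m P *m x)^T ord0 ord0); last by rewrite mxE.
by rewrite !trmx_mul PT trmxK mulmxA.
Qed.

(** The rank-one term penalises the direction of [s]; it turns a semidefinite form with kernel
    spanned by [s] into a definite one. *)
Lemma bform_rank1 (R : realType) n (P : 'M[R]_n) (s x : 'cV[R]_n) :
  bform (P + s *m s^T) x x = bform P x x + (\sum_i s i ord0 * x i ord0) ^+ 2.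
Proof.
rewrite /bform mulmxDr mulmxDl mxE; congr (_ + _).
rewrite mulmxA -mulmxA mxE big_ord1 expr2; congr (_ * _).
  by rewrite mxE; apply: eq_bigr => i _; rewrite mxE mulrC.
by rewrite mxE; apply: eq_bigr => i _; rewrite mxE.
Qed.

Definition pos_def (R : realType) n (P : 'M[R]_n) :=
  [/\ P^T = P, forall x, 0 <= bform P x x & forall x, bform P x x = 0 -> x = 0].

Lemma cauchy_schwarz (R : realType) n (P : 'M[R]_n) x y : pos_def P ->
  bform P x y ^+ 2 <= bform P x x * bform P y y.
Proof.
case=> PT P_ge0 P0.
have [/P0->|y_neq0] := eqVneq (bform P y y) 0.
  by rewrite /bform !mulmx0 mxE expr0n mulr0.
have y_gt0 : 0 < bform P y y by rewrite lt_neqAle eq_sym y_neq0 P_ge0.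
(* A multiple of the component of [x] orthogonal to [y] for [P]. *)
have := P_ge0 (bform P y y *: x - bform P x y *: y).
set a := bform P x x; set b := bform P y y; set m := bform P x y.
have -> : bform P (b *: x - m *: y) (b *: x - m *: y) = b * (a * b - m ^+ 2).
  transitivity (b ^+ 2 * a - b * m * bform P x y - b * m * bform P y x
                + m ^+ 2 * b).
    have trB : (b *: x - m *: y)^T = b *: x^T - m *: y^T.
      by rewrite linearB/= !linearZ.
    rewrite {1}/bform trB !mulmxBl !mulmxBr -!scalemxAl -!scalemxAr.
    have subE (A B : 'M[R]_1) : (A - B) ord0 ord0 = A ord0 ord0 - B ord0 ord0.
      by rewrite !mxE.
    have scaleE k (A : 'M[R]_1) : (k *: A) ord0 ord0 = k * A ord0 ord0.
      by rewrite mxE.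
    by rewrite !(subE, scaleE) /b /a /bform; ring.
  by rewrite (bformC y x PT) -/m; ring.
by rewrite pmulr_rge0// subr_ge0.
Qed.

Lemma pos_def_unitmx (R : realType) n (P : 'M[R]_n) : pos_def P -> P \in unitmx.
Proof.
case=> PT P_ge0 P0; rewrite unitmxE unitfE; apply/negP => /det0P[v v_neq0 vP].
suff /P0/(congr1 trmx) : bform P v^T v^T = 0.
  by rewrite trmxK trmx0 => v0; rewrite v0 eqxx in v_neq0.
by rewrite /bform trmxK vP mul0mx mxE.
Qed.

(* Cauchy-Schwarz against [P^-1 e_i], which represents the [i]-th coordinate. *)
Lemma pos_def_coercive (R : realType) n (P : 'M[R]_n) : pos_def P ->
  exists2 c : R, 0 < c & forall x : 'cV_n,
    \sum_i x i ord0 ^+ 2 <= c * bform P x x.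
Proof.
move=> Ppos; have [PT P_ge0 _] := Ppos.
pose y i : 'cV[R]_n := invmx P *m delta_mx i ord0.
(* The added 1 keeps the constant positive even when the sum is empty. *)
exists (1 + \sum_i bform P (y i) (y i)).
  by rewrite ltr_pwDl// sumr_ge0.
move=> x; rewrite mulrDl mul1r mulr_suml; apply: le_trans (_ : _ <= \sum_i _) _.
  apply: ler_sum => i _; apply: le_trans (cauchy_schwarz (y i) x Ppos).
  rewrite /bform /y trmx_mul trmx_inv PT mulmxKV ?pos_def_unitmx//.
  by rewrite trmx_delta -rowE mxE.
by rewrite lerDr.
Qed.

(** * Quadratic form of a symmetric signed Laplacian *)

Section SymmetricLaplacian.
Variables (R : realType) (n : nat) (W : 'M[R]_n).
Hypothesis W_sym : W^T = W.
Let L := abs_degree_mx W - W.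

Let WC i j : W i j = W j i. Proof. by rewrite -{1}W_sym mxE. Qed.

Lemma laplacian_mulE (x : 'cV[R]_n) i :
  (L *m x) i ord0 = \sum_j (`|W i j| * x i ord0 - W i j * x j ord0).
Proof.
rewrite mulmxBl mul_diag_mx !mxE sumrB mulr_suml; congr (_ - _).
Qed.

Lemma laplacian_tr : L^T = L.
Proof. by rewrite linearB/= tr_diag_mx W_sym. Qed.

(** Symmetry of [W] lets the degree term be shared evenly between [i] and [j]. Each summand is
    |w_ij| (x_i - sgn(w_ij) x_j)^2, expanded so that no sign function appears. *)
Lemma laplacian_bform (x : 'cV[R]_n) : bform L x x =
  2^-1 * \sum_i \sum_j (`|W i j| * (x i ord0 ^+ 2 + x j ord0 ^+ 2)
                        - 2 * (W i j * x i ord0 * x j ord0)).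
Proof.
have S : \sum_i \sum_j `|W i j| * x i ord0 ^+ 2
       = \sum_i \sum_j `|W i j| * x j ord0 ^+ 2.
  rewrite exchange_big; apply: eq_bigr => i _; apply: eq_bigr => j _.
  by rewrite WC.
transitivity (\sum_i \sum_j `|W i j| * x i ord0 ^+ 2
              - \sum_i \sum_j W i j * x i ord0 * x j ord0).
  rewrite bformE -sumrB; apply: eq_bigr => i _.
  rewrite laplacian_mulE mulr_sumr -sumrB; apply: eq_bigr => j _; ring.
apply: (@mulfI _ 2); rewrite ?pnatr_eq0// mulrA divff ?pnatr_eq0// mul1r.
transitivity (\sum_i \sum_j `|W i j| * x i ord0 ^+ 2
   + \sum_i \sum_j `|W i j| * x j ord0 ^+ 2
   - 2 * \sum_i \sum_j W i j * x i ord0 * x j ord0); first by rewrite -S; ring.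
rewrite mulr_sumr -big_split -sumrB; apply: eq_bigr => i _.
rewrite mulr_sumr -big_split -sumrB; apply: eq_bigr => j _ /=; ring.
Qed.

Let term_ge0 (x : 'cV[R]_n) i j :
  0 <= `|W i j| * (x i ord0 ^+ 2 + x j ord0 ^+ 2)
       - 2 * (W i j * x i ord0 * x j ord0).
Proof.
have sqx (y : R) : `|y| ^+ 2 = y ^+ 2 by rewrite real_normK// num_real.
rewrite subr_ge0; apply: le_trans (ler_norm _) _.
rewrite !normrM ger0_norm// -(sqx (x i ord0)) -(sqx (x j ord0)).
rewrite -subr_ge0.
have -> : `|W i j| * (`|x i ord0| ^+ 2 + `|x j ord0| ^+ 2)
  - 2 * (`|W i j| * `|x i ord0| * `|x j ord0|)
  = `|W i j| * (`|x i ord0| - `|x j ord0|) ^+ 2 by ring.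
by rewrite mulr_ge0// sqr_ge0.
Qed.

Lemma laplacian_bform_ge0 x : 0 <= bform L x x.
Proof.
rewrite laplacian_bform mulr_ge0 ?invr_ge0//.
by apply: sumr_ge0 => i _; apply: sumr_ge0 => j _.
Qed.

(** A sum of nonnegative terms vanishes only termwise, and |w_ij| times the (i, j) term is the
    square of the difference of the two sides. *)
Lemma laplacian_bform_eq0 x : bform L x x = 0 ->
  forall i j, `|W i j| * x i ord0 = W i j * x j ord0.
Proof.
rewrite laplacian_bform => /eqP; rewrite mulf_eq0 invr_eq0 pnatr_eq0/=.
move=> /eqP sum0 i j.
have /psumr_eq0P/(_ sum0 i isT) : forall k, true ->
    0 <= \sum_l (`|W k l| * (x k ord0 ^+ 2 + x l ord0 ^+ 2)
                 - 2 * (W k l * x k ord0 * x l ord0)).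
  by move=> k _; apply: sumr_ge0 => l _.
move=> /psumr_eq0P/(_ j isT)-/(_ (fun l _ => term_ge0 x i l)) t0.
apply/eqP; rewrite -subr_eq0 -sqrf_eq0.
have sqW : `|W i j| ^+ 2 = W i j ^+ 2 by rewrite real_normK// num_real.
have -> : (`|W i j| * x i ord0 - W i j * x j ord0) ^+ 2
  = `|W i j| * (`|W i j| * (x i ord0 ^+ 2 + x j ord0 ^+ 2)
       - 2 * (W i j * x i ord0 * x j ord0)).
  by rewrite sqrrB [(W i j * _) ^+ 2]exprMn -sqW; ring.
by rewrite t0 mulr0.
Qed.

End SymmetricLaplacian.

(** * Sign vectors and structural balance *)

Definition sign_vector (R : realType) n (s : 'I_n -> R) :=
  forall i, s i = 1 \/ s i = -1.

Lemma sign_vectorM (R : realType) n (s : 'I_n -> R) i :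
  sign_vector s -> s i * s i = 1.
Proof. by case/(_ i) => ->; rewrite ?mulr1// mulrNN mulr1. Qed.

Lemma sign_vector_norm (R : realType) n (s : 'I_n -> R) i :
  sign_vector s -> `|s i| = 1.
Proof. by case/(_ i) => ->; rewrite ?normrN normr1. Qed.

(** Flipping signs by [s] makes all weights nonnegative, and an unsigned Laplacian kills constants;
    undoing the flip turns the constant vector into [s]. *)
Lemma laplacian_sign_kernel (R : realType) n (W : 'M[R]_n) (s : 'I_n -> R) :
  sign_vector s -> (forall i j, 0 <= s i * s j * W i j) ->
  (abs_degree_mx W - W) *m (\col_i s i) = 0.
Proof.
move=> s1 sW; apply/colP => i; rewrite [LHS]laplacian_mulE [RHS]mxE.
apply: big1 => j _; rewrite !mxE.
have -> : `|W i j| = s i * s j * W i j.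
  by rewrite -(ger0_norm (sW i j)) !normrM !(sign_vector_norm _ s1) !mul1r.
apply/eqP; rewrite subr_eq0; apply/eqP.
transitivity ((s i * s i) * (W i j * s j)); first by ring.
by rewrite sign_vectorM// mul1r.
Qed.

(** Signs in place of a partition merge the two conditions on weights into one inequality, the form
    of balance used below. *)
Lemma balancedP (R : realType) n (G : signed_digraph R n) :
  structurally_balanced G <->
  exists2 s : 'I_n -> R, sign_vector s
    & forall i j, 0 <= s i * s j * weight G i j.
Proof.
split=> [[V1 [V2 [V12 dV same opp]]]|[s s1 sG]].
  have V2E i : (i \in V2) = (i \notin V1).
    apply/idP/idP => [iV2|iV1]; last first.
      by have := finset.in_setT i; rewrite -V12 inE (negbTE iV1).
    by apply/negP => iV1; have := disjointFr dV iV1; rewrite iV2.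
  exists (fun i => if i \in V1 then 1 else -1).
    by move=> i; case: ifP; [left|right].
  move=> i j; have := same i j; have := opp i j; rewrite !V2E.
  by case: (i \in V1); case: (j \in V1) => /= Ho Hs;
    rewrite ?(mulrNN, mulr1, mul1r, mulN1r) ?mulNr ?mul1r ?oppr_ge0 ?Ho ?Hs.
exists [set i | s i == 1]%SET, [set i | s i != 1]%SET; split.
- by apply/setP => i; rewrite !inE orbN.
- by rewrite finset.disjoints_subset; apply/fintype.subsetP => i; rewrite !inE negbK.
- have sE i : s i != 1 -> s i = -1 by case: (s1 i) => -> //; rewrite eqxx.
  move=> i j; rewrite !inE => /orP[|] /andP[].
    by move=> /eqP si /eqP sj; have := sG i j; rewrite si sj !mul1r.
  by move=> /sE si /sE sj; have := sG i j; rewrite si sj mulrNN !mul1r.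
- have sE i : s i != 1 -> s i = -1 by case: (s1 i) => -> //; rewrite eqxx.
  move=> i j; rewrite !inE => /orP[|] /andP[].
    move=> /eqP si /sE sj; have := sG i j.
    by rewrite si sj mul1r mulN1r oppr_ge0.
  move=> /sE si /eqP sj; have := sG i j.
  by rewrite si sj mulr1 mulN1r oppr_ge0.
Qed.

(** * Signs, kernel and definiteness of the mirror Laplacian *)

Section Mirror.
Variables (R : realType) (n : nat) (G : signed_digraph R n).
Hypothesis Gc : strongly_connected G.
Let W := mirror_weight G.
Let d i := principal_minor (unsigned_laplacian G) i.

Let WE i j : W i j = 2^-1 * (d i * weight G i j + d j * weight G j i).
Proof. by rewrite mxE. Qed.

Let d_gt0 i : 0 < d i. Proof. exact: principal_minor_gt0. Qed.

Lemma mirror_weight_tr : W^T = W.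
Proof. by apply/matrixP => i j; rewrite [LHS]mxE !WE addrC. Qed.

(** By digon sign-symmetry and positivity of the minors, the two summands of a mirror weight never
    have opposite signs, so they cannot cancel. *)
Lemma mirror_weight_sign i j :
  weight G i j != 0 -> 0 < W i j * weight G i j.
Proof.
move=> a_neq0; rewrite WE -mulrA pmulr_rgt0 ?invr_gt0//.
have -> : (d i * weight G i j + d j * weight G j i) * weight G i j
  = d i * weight G i j ^+ 2 + d j * (weight G i j * weight G j i) by ring.
apply: ltr_wpDr; first by rewrite mulr_ge0 ?digon_sign_symmetry ?(ltW (d_gt0 j)).
by rewrite mulr_gt0// exprn_even_gt0.
Qed.

Lemma mirror_weight_balanced (s : 'I_n -> R) :
  (forall i j, 0 <= s i * s j * weight G i j) ->
  forall i j, 0 <= s i * s j * W i j.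
Proof.
move=> sG i j; rewrite WE.
have -> : s i * s j * (2^-1 * (d i * weight G i j + d j * weight G j i))
  = 2^-1 * (d i * (s i * s j * weight G i j) + d j * (s j * s i * weight G j i)).
  by ring.
by rewrite mulr_ge0 ?invr_ge0// addr_ge0// mulr_ge0// ltW.
Qed.

Let edge_eq x i j : bform (mirror_laplacian G) x x = 0 -> weight G i j != 0 ->
  W i j != 0 /\ `|W i j| * x i ord0 = W i j * x j ord0.
Proof.
move=> x0 a_neq0; split; last exact: laplacian_bform_eq0 mirror_weight_tr _ x0 _ _.
by have := mirror_weight_sign a_neq0; apply: contraTneq => ->; rewrite mul0r ltxx.
Qed.

(** Taking moduli in [edge_eq] and cancelling the nonzero mirror weight equates the moduli across
    each edge. *)
Lemma mirror_kernel_norm x i j : bform (mirror_laplacian G) x x = 0 ->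
  `|x i ord0| = `|x j ord0|.
Proof.
move=> x0; have [->//|ij] := eqVneq i j.
apply: (@connect_pullback _ (edge G) (fun k => `|x k ord0| = `|x j ord0|) i j) => //.
  move=> u v /= /(edge_eq x0)[W0 E] <-; apply: (@mulfI _ `|W v u|).
    by rewrite normr_eq0.
  by rewrite -normrM -E normrM normr_id.
exact: Gc.
Qed.

Lemma mirror_unbalanced_kernel x : structurally_unbalanced G ->
  bform (mirror_laplacian G) x x = 0 -> x = 0.
Proof.
move=> Gu x0; apply/colP => i; rewrite mxE; apply/eqP/negP => /negP xi.
apply: Gu; apply/balancedP.
set c := `|x i ord0|; have c_gt0 : 0 < c by rewrite normr_gt0.
(* All entries have modulus [c], so the quotients are signs. *)
exists (fun j => x j ord0 / c).
  move=> j; have := mirror_kernel_norm j i x0; rewrite -/c => xj.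
  move/eqP: xj; rewrite eqr_norml => /andP[/orP[]/eqP-> _].
    by left; rewrite divff ?gt_eqF.
  by right; rewrite mulNr divff ?gt_eqF.
move=> j k; have -> : x j ord0 / c * (x k ord0 / c) * weight G j k
    = c^-1 ^+ 2 * (x j ord0 * x k ord0 * weight G j k) by ring.
rewrite mulr_ge0 ?sqr_ge0//.
have [->|a_neq0] := eqVneq (weight G j k) 0; first by rewrite mulr0.
have [W0 E] := edge_eq x0 a_neq0.
have aW := mirror_weight_sign a_neq0.
(* The positive factor w_jk^2 makes room for the kernel relation [E], which replaces w_jk x_k by
   |w_jk| x_j. *)
rewrite -(@pmulr_rge0 _ (W j k ^+ 2)) ?exprn_even_gt0//.
have -> : W j k ^+ 2 * (x j ord0 * x k ord0 * weight G j k)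
  = (W j k * weight G j k) * (x j ord0 * (W j k * x k ord0)) by ring.
rewrite -E mulr_ge0 ?(ltW aW)//.
have -> : x j ord0 * (`|W j k| * x j ord0) = `|W j k| * x j ord0 ^+ 2 by ring.
by rewrite mulr_ge0// sqr_ge0.
Qed.

(** At a zero of the form, s_j x_j does not depend on j, so orthogonality to [s] makes n times the
    common value zero. *)
Lemma mirror_balanced_kernel (s : 'I_n -> R) x :
  sign_vector s -> (forall i j, 0 <= s i * s j * weight G i j) ->
  bform (mirror_laplacian G) x x = 0 -> \sum_i s i * x i ord0 = 0 -> x = 0.
Proof.
move=> s1 sG x0 sx0; apply/colP => i; rewrite mxE.
have sx j : s j * x j ord0 = s i * x i ord0.
  have [->//|ji] := eqVneq j i.
  apply: (@connect_pullback _ (edge G)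
    (fun k => s k * x k ord0 = s i * x i ord0) j i) => //; last exact: Gc.
  move=> u v /= /(edge_eq x0)[W0 E] <-; apply: (mulfI W0).
  have Wn : `|W v u| = s v * s u * W v u.
    rewrite -(ger0_norm (mirror_weight_balanced sG v u)) !normrM.
    by rewrite !(sign_vector_norm _ s1) !mul1r.
  rewrite mulrCA -E Wn.
  transitivity ((s u * s u) * (W v u * (s v * x v ord0))); first by ring.
  by rewrite sign_vectorM// mul1r.
move: sx0; under eq_bigr do rewrite sx.
rewrite sumr_const card_ord => /eqP; rewrite mulrn_eq0.
rewrite gtn_eqF/= ?(leq_ltn_trans _ (ltn_ord i))// mulf_eq0.
move=> /orP[|/eqP//] /eqP si.
by have := sign_vectorM i s1; rewrite si mul0r => /esym/eqP; rewrite oner_eq0.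
Qed.

Lemma mirror_unbalanced_pos_def :
  structurally_unbalanced G -> pos_def (mirror_laplacian G).
Proof.
move=> Gu; split; first exact: laplacian_tr mirror_weight_tr.
  exact: laplacian_bform_ge0 mirror_weight_tr.
by move=> x; exact: mirror_unbalanced_kernel.
Qed.

Lemma mirror_balanced_pos_def (s : 'I_n -> R) :
  sign_vector s -> (forall i j, 0 <= s i * s j * weight G i j) ->
  pos_def (mirror_laplacian G + (\col_i s i) *m (\col_i s i)^T).
Proof.
move=> s1 sG; have L_ge0 := laplacian_bform_ge0 mirror_weight_tr.
split.
- by rewrite linearD/= trmx_mul trmxK (laplacian_tr mirror_weight_tr).
- by move=> x; rewrite bform_rank1 addr_ge0 ?sqr_ge0.
- move=> x; rewrite bform_rank1 => /eqP; rewrite paddr_eq0 ?sqr_ge0//.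
  rewrite sqrf_eq0 => /andP[/eqP x0 /eqP sx].
  apply: mirror_balanced_kernel s1 sG x0 _; rewrite -[RHS]sx.
  by apply: eq_bigr => i _; rewrite mxE.
Qed.

End Mirror.

Local Open Scope classical_set_scope.

(** * Calculus on the half-line and exponential decay *)

Lemma MVT_halfline (R : realType) (f df : R -> R) (t : R) :
  {within `[0, +oo[, continuous f} ->
  (forall s : R, 0 < s -> is_derive s 1 f (df s)) -> 0 < t ->
  exists2 c, 0 < c & f t - f 0 = df c * t.
Proof.
move=> fc fd t_gt0.
have [||c] := @MVT R f df 0 t t_gt0.
- by move=> s; rewrite in_itv/= => /andP[s_gt0 _]; exact: fd.
- apply: continuous_subspaceW fc => s /=; rewrite !in_itv/=.
  by move=> /andP[->].
by rewrite in_itv/= subr0 => /andP[c_gt0 _] ->; exists c.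
Qed.

Lemma is_derive_sumE (R : realType) n (f : 'I_n -> R -> R) (df : 'I_n -> R) (t : R) :
  (forall i, is_derive t 1 (f i) (df i)) ->
  is_derive t 1 (fun s => \sum_i f i s) (\sum_i df i).
Proof. by move=> fd; rewrite -fct_sumE; exact: is_derive_sum. Qed.

Lemma within_continuous_sum (R : realType) n (A : set R) (f : 'I_n -> R -> R) :
  (forall i, {within A, continuous (f i)}) ->
  {within A, continuous (fun t => \sum_i f i t)}.
Proof.
move=> fc z; apply: (@cvg_big _ _ +%R 0 xpredT) => [|i _]; last exact: fc.
exact: add_continuous.
Qed.

Lemma within_continuousM (R : realType) (A : set R) (f g : R -> R) :
  {within A, continuous f} -> {within A, continuous g} ->
  {within A, continuous (fun t => f t * g t)}.
Proof. by move=> fc gc z; apply: cvgM; [exact: fc | exact: gc]. Qed.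

(** The square is squeezed between 0 and the exponential, and continuity of the square root carries
    the limit over to the modulus. *)
Lemma sqr_expR_decay_cvg0 (R : realType) (f : R -> R) (V k : R) : 0 < k ->
  (forall t, 0 < t -> f t ^+ 2 <= V * expR (- (k * t))) ->
  f t @[t --> +oo] --> (0 : R).
Proof.
move=> k_gt0 fV; apply: norm_cvg0.
have -> : (fun t => `|f t|) = (fun t => Num.sqrt (f t ^+ 2)).
  by apply/funext => t; rewrite sqrtr_sqr.
rewrite -[X in _ --> X]sqrtr0.
apply: (@cvg_comp _ _ _ (fun t => f t ^+ 2) Num.sqrt); last first.
  exact: sqrt_continuous.
have kexp : V * expR (- (k * t)) @[t --> +oo] --> (0 : R).
  rewrite -[X in _ --> X](mulr0 V); apply: cvgMl_tmp.
  apply: (@cvg_comp _ _ _ (fun t => k * t) (fun t => expR (- t))); last first.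
    exact: cvgr_expR.
  by apply: gt0_cvgMry => //; exact: cvg_id.
apply: (squeeze_cvgr _ (cvg_cst 0) kexp).
near=> t; rewrite sqr_ge0 fV//; near: t.
Unshelve. all: by end_near. Qed.

(* With [|x|^2 <= c (x^T P x)], [e^(2t/c) |y t|^2] is nonincreasing. *)
Lemma pos_def_stable (R : realType) n (P : 'M[R]_n) (y : R -> 'cV[R]_n) :
  pos_def P -> trajectory (- P) y -> forall i, y t i ord0 @[t --> +oo] --> (0 : R).
Proof.
move=> Ppos traj i; have [c c_gt0 cP] := pos_def_coercive Ppos.
pose k := 2 / c; have k_gt0 : 0 < k by rewrite divr_gt0.
pose V t := \sum_j y t j ord0 * y t j ord0.
have VE t : V t = \sum_j y t j ord0 ^+ 2.
  by apply: eq_bigr => j _; rewrite expr2.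
have expkd (t : R) : is_derive t 1 (fun s => expR (k * s)) (expR (k * t) * k).
  apply: (@is_derive1_comp _ expR (fun s => k * s)).
  have := @is_deriveZ _ _ _ (@id R) k t 1 1 (is_derive_id _ _).
  by rewrite [k *: 1]mulr1.
pose dV t := \sum_j 2 * (y t j ord0 * (- P *m y t) j ord0).
have Vd (t : R) : 0 < t -> is_derive t 1 V (dV t).
  move=> t_gt0; apply: is_derive_sumE => j.
  have yd := (traj j).2 t t_gt0.
  apply: is_derive_eq (is_deriveM yd yd) _.
  by rewrite mulr_natl mulr2n.
have Vc : {within `[0, +oo[, continuous V}.
  apply: within_continuous_sum => j.
  by apply: within_continuousM; exact: (traj j).1.
have decay t : 0 < t -> V t <= V 0 * expR (- (k * t)).
  move=> t_gt0; rewrite expRN -ler_pdivrMr ?invr_gt0 ?expR_gt0// invrK.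
  suff : V t * expR (k * t) <= V 0 * expR (k * 0) by rewrite mulr0 expR0 mulr1.
  rewrite -subr_le0.
  have Fc : {within `[0, +oo[, continuous (fun s => V s * expR (k * s))}.
    apply: within_continuousM Vc _; apply: continuous_subspaceT => s.
    by apply: differentiable_continuous; apply/derivable1_diffP; case: (expkd s).
  have Fd (s : R) : 0 < s -> is_derive s 1 (fun s => V s * expR (k * s))
      (V s * (expR (k * s) * k) + expR (k * s) * dV s).
    by move=> s_gt0; exact: is_deriveM (Vd s s_gt0) (expkd s).
  (* The mean value theorem reduces the comparison with time 0 to the sign of one derivative. *)
  have [s s_gt0 ->] := MVT_halfline Fc Fd t_gt0.
  rewrite pmulr_lle0//.
  have -> : V s * (expR (k * s) * k) + expR (k * s) * dV s
    = expR (k * s) * (k * V s + dV s) by ring.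
  rewrite pmulr_rle0 ?expR_gt0//.
  have -> : dV s = - (2 * bform P (y s) (y s)).
    rewrite bformE mulr_sumr -sumrN; apply: eq_bigr => j _.
    by rewrite mulNmx mxE; ring.
  (* Since [k = 2 / c], the claim is equivalent to the coercivity bound at [y s]. *)
  rewrite subr_le0 /k -mulrA ler_pM2l// ler_pdivrMl// VE.
  exact: cP.
apply: (sqr_expR_decay_cvg0 k_gt0) => t t_gt0.
apply: le_trans (decay t t_gt0); rewrite VE (bigD1 i)//= lerDl.
by apply: sumr_ge0 => j _; rewrite sqr_ge0.
Qed.

(** * Existence of trajectories by the matrix exponential series *)

Section Existence.
Variables (R : realType) (n : nat) (M : 'M[R]_n).

(** Power series coefficients in t of the [i]-th coordinate of exp(t M) x0. *)
Definition exp_mx_coeff (x0 : 'cV[R]_n) i k : R :=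
  iter k (mulmx M) x0 i ord0 / k`!%:R.

(** The sum of the moduli of all entries bounds the operator norm of [M] for the l1 norm. *)
Lemma iter_mulmx_bound (x0 : 'cV[R]_n) k :
  \sum_i `|iter k (mulmx M) x0 i ord0|
  <= (\sum_i \sum_j `|M i j|) ^+ k * \sum_i `|x0 i ord0|.
Proof.
elim: k => [|k IHk]; first by rewrite expr0 mul1r.
rewrite exprS -mulrA; apply: le_trans (ler_wpM2l _ IHk); last first.
  by apply: sumr_ge0 => i _; apply: sumr_ge0.
rewrite mulr_suml; apply: ler_sum => i _; rewrite iterS mxE mulr_suml.
apply: le_trans (ler_norm_sum _ _ _) _; apply: ler_sum => j _.
rewrite normrM ler_wpM2l// [leRHS](bigD1 j)//= lerDl.
by apply: sumr_ge0.
Qed.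

Lemma is_cvg_exp_mx x0 i (t : R) : cvgn (pseries (exp_mx_coeff x0 i) t).
Proof.
set C := \sum_i \sum_j `|M i j|; set B := \sum_i `|x0 i ord0|.
have C_ge0 : 0 <= C by apply: sumr_ge0 => j _; apply: sumr_ge0.
have B_ge0 : 0 <= B by apply: sumr_ge0.
apply: normed_cvg; apply: (@series_le_cvg _ _ (B *: exp_coeff (C * `|t|))).
- by move=> k /=.
- move=> k; rewrite /exp_coeff/= mulr_ge0// divr_ge0// exprn_ge0//.
  by rewrite mulr_ge0.
- move=> k /=; rewrite /exp_mx_coeff /exp_coeff/= !normrM normfV normrX.
  rewrite [`|k`!%:R|]ger0_norm// mulrAC.
  rewrite [leRHS]mulrA ler_wpM2r ?invr_ge0// exprMn mulrA ler_wpM2r ?exprn_ge0//.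
  rewrite [leRHS]mulrC; apply: le_trans (iter_mulmx_bound x0 k).
  by rewrite [leRHS](bigD1 i)//= lerDl; apply: sumr_ge0.
- by apply: is_cvg_seriesZ; exact: is_cvg_series_exp_coeff.
Qed.

(** Formal differentiation amounts to replacing [x0] by [M *m x0], so all derived series are of the
    same kind and converge as well. *)
Lemma exp_mx_coeff_diffs x0 i :
  pseries_diffs (exp_mx_coeff x0 i) = exp_mx_coeff (M *m x0) i.
Proof.
apply/funext => k; rewrite /pseries_diffs /exp_mx_coeff -iterSr factS natrM.
by rewrite invfM mulrCA mulVKf// pnatr_eq0.
Qed.

Lemma lim_exp_mx_mul x0 i (t : R) :
  limn (pseries (exp_mx_coeff (M *m x0) i) t)
  = \sum_j M i j * limn (pseries (exp_mx_coeff x0 j) t).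
Proof.
apply: cvg_lim => //.
have -> : pseries (exp_mx_coeff (M *m x0) i) t
    = fun m => \sum_j M i j * pseries (exp_mx_coeff x0 j) t m.
  apply/funext => m; rewrite /pseries /series/=.
  under [RHS]eq_bigr do rewrite mulr_sumr.
  rewrite [RHS]exchange_big; apply: eq_bigr => k _ /=.
  rewrite /exp_mx_coeff -iterSr iterS mxE !mulr_suml.
  by apply: eq_bigr => j _; rewrite !mulrA.
apply: (@cvg_big _ _ +%R 0 xpredT) => [|j _]; first exact: add_continuous.
by apply: cvgMl_tmp; exact: is_cvg_exp_mx.
Qed.

Lemma trajectory_exists x0 : exists2 x, trajectory M x & x 0 = x0.
Proof.
pose x t : 'cV[R]_n := \col_i limn (pseries (exp_mx_coeff x0 i) t).
have xE i : (fun t => x t i ord0) = fun t => limn (pseries (exp_mx_coeff x0 i) t).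
  by apply/funext => t; rewrite mxE.
have xd i (t : R) : is_derive t 1 (fun s => x s i ord0) ((M *m x t) i ord0).
  have -> : (M *m x t) i ord0 = limn (pseries (exp_mx_coeff (M *m x0) i) t).
    by rewrite lim_exp_mx_mul mxE; apply: eq_bigr => j _; rewrite mxE.
  rewrite xE -exp_mx_coeff_diffs.
  (* Any point beyond |t| would do, as the series converge everywhere. *)
  apply: (@pseries_snd_diffs _ _ (`|t| + 1)).
  - exact: is_cvg_exp_mx.
  - by rewrite exp_mx_coeff_diffs; exact: is_cvg_exp_mx.
  - by rewrite !exp_mx_coeff_diffs; exact: is_cvg_exp_mx.
  - by rewrite [ltRHS]ger0_norm ?addr_ge0// ltrDl.
exists x.
  move=> i; split=> [|t _]; last exact: xd.
  apply: continuous_subspaceT => t.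
  by apply: differentiable_continuous; apply/derivable1_diffP; case: (xd i t).
apply/colP => i; rewrite mxE; apply: lim_near_cst => //.
(* At time 0 only the term of index 0 survives, and every partial sum with [m >= 1] contains it. *)
near=> m; rewrite /pseries /series/= -[m]prednK; last by near: m; exists 1%N.
rewrite big_nat_recl//= big1 => [|k _]; last by rewrite expr0n mulr0.
by rewrite /exp_mx_coeff/= fact0 divr1 expr0 mulr1 addr0.
Unshelve. all: by end_near. Qed.

End Existence.

(** * Conservation law and the four implications *)

(** The derivative of s^T x is - s^T P x, which is zero because [P] is symmetric and kills [s]. *)
Lemma kernel_conserved (R : realType) n (P : 'M[R]_n) (s : 'cV[R]_n)
    (x : R -> 'cV[R]_n) (t : R) :
  P^T = P -> P *m s = 0 -> trajectory (- P) x -> 0 <= t ->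
  \sum_i s i ord0 * x t i ord0 = \sum_i s i ord0 * x 0 i ord0.
Proof.
move=> PT Ps traj; rewrite le_eqVlt => /predU1P[<-//|t_gt0].
have fc : {within `[0, +oo[, continuous (fun t => \sum_i s i ord0 * x t i ord0)}.
  apply: within_continuous_sum => i.
  by apply: within_continuousM; [exact: cst_continuous | exact: (traj i).1].
have fd (r : R) : 0 < r -> is_derive r 1 (fun t => \sum_i s i ord0 * x t i ord0)
    (\sum_i s i ord0 * (- P *m x r) i ord0).
  move=> r_gt0; apply: is_derive_sumE => i.
  exact: is_deriveZ ((traj i).2 r r_gt0).
have [c _ /eqP] := MVT_halfline fc fd t_gt0.
rewrite -bformE bformC ?linearN/= ?PT//.
by rewrite /bform mulmxN mulNmx -mulmxA Ps mulmx0 oppr0 mxE mul0r subr_eq0 => /eqP.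
Qed.

Lemma unbalanced_state_stability (R : realType) n (G : signed_digraph R n) :
  strongly_connected G -> structurally_unbalanced G ->
  state_stability (- mirror_laplacian G).
Proof.
move=> Gc Gu x0 x traj _; apply: pos_def_stable traj.
exact: mirror_unbalanced_pos_def.
Qed.

(* The deviation [y] of [x] from its limit stays orthogonal to the sign vector
   [s], where [L] and the positive definite [L + s s^T] agree. *)
Lemma balanced_signed_average_consensus (R : realType) n
    (G : signed_digraph R n) :
  strongly_connected G -> structurally_balanced G ->
  signed_average_consensus (- mirror_laplacian G).
Proof.
move=> Gc /balancedP[s s1 sG] x0; exists s; split=> // x traj x0E i.
set L := mirror_laplacian G in traj *; set a := \sum_j _.
pose v : 'cV[R]_n := \col_j s j.
have Lv : L *m v = 0.
  by apply: laplacian_sign_kernel => //; exact: mirror_weight_balanced.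
have LT : L^T = L by apply: laplacian_tr; exact: mirror_weight_tr.
have n_neq0 : n%:R != 0 :> R.
  by rewrite pnatr_eq0 gtn_eqF// (leq_ltn_trans _ (ltn_ord i)).
pose y t := x t - (a / n%:R) *: v.
(* As s^T s = n and s^T x keeps its initial value [a], subtracting (a / n) s leaves no component
   along s. *)
have vy (t : R) : 0 <= t -> v^T *m y t = 0.
  move=> t_ge0; apply/rowP => k; rewrite (ord1 k) [RHS]mxE mulmxBr -scalemxAr.
  have -> : v^T *m v = n%:R%:M.
    apply/rowP => l; rewrite (ord1 l) !mxE -[n in RHS]card_ord -sumr_const.
    by apply: eq_bigr => j _; rewrite !mxE sign_vectorM.
  rewrite !mxE mulr1n divfK//; apply/eqP; rewrite subr_eq0; apply/eqP.
  transitivity (\sum_j v j ord0 * x t j ord0).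
    by apply: eq_bigr => j _; rewrite !mxE.
  rewrite (kernel_conserved LT Lv traj t_ge0) x0E.
  by apply: eq_bigr => j _; rewrite !mxE.
have ytraj : trajectory (- (L + v *m v^T)) y.
  have yE j : (fun t => y t j ord0)
      = (fun t => x t j ord0 - (a / n%:R) * s j).
    by apply/funext => t; rewrite !mxE.
  move=> j; rewrite yE; split.
    apply: within_continuousB; first exact: (traj j).1.
    exact: cst_continuous.
  move=> t t_gt0.
  have -> : - (L + v *m v^T) *m y t = - L *m x t.
    rewrite mulNmx mulmxDl -mulmxA vy ?ltW// mulmx0 addr0 mulmxBr -scalemxAr Lv.
    by rewrite scaler0 subr0 mulNmx.
  rewrite -[X in is_derive _ _ _ X]subr0.
  exact: is_deriveB ((traj j).2 t t_gt0) (is_derive_cst _ _ _).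
have yi := pos_def_stable (mirror_balanced_pos_def Gc s1 sG) ytraj i.
have -> : (fun t => x t i ord0) = (fun t => y t i ord0 + s i / n%:R * a).
  by apply/funext => t; rewrite !mxE; ring.
rewrite -[X in _ --> X]add0r; apply: cvgD yi _; exact: cvg_cst.
Qed.

Lemma state_stability_unbalanced (R : realType) n (G : signed_digraph R n) :
  (0 < n)%N -> strongly_connected G ->
  state_stability (- mirror_laplacian G) -> structurally_unbalanced G.
Proof.
move=> n_gt0 Gc stable /balancedP[s s1 sG].
pose v : 'cV[R]_n := \col_j s j; pose i := Ordinal n_gt0.
have Lv : mirror_laplacian G *m v = 0.
  by apply: laplacian_sign_kernel => //; exact: mirror_weight_balanced.
have traj : trajectory (- mirror_laplacian G) (fun=> v).
  move=> j; split; first exact: cst_continuous.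
  move=> t _; rewrite mulNmx Lv oppr0 [X in is_derive _ _ _ X]mxE.
  exact: is_derive_cst.
(* The constant trajectory tends both to itself and to 0, so a sign would be 0. *)
have v_v : v i ord0 @[_ --> pinfty_nbhs R] --> v i ord0 by exact: cvg_cst.
have := cvg_unique (@Rhausdorff R) v_v (stable v _ traj erefl i).
rewrite mxE => si; have := sign_vectorM i s1; rewrite si.
by rewrite mul0r => /esym/eqP; rewrite oner_eq0.
Qed.

Lemma signed_average_consensus_balanced (R : realType) n
    (G : signed_digraph R n) :
  (0 < n)%N -> strongly_connected G ->
  signed_average_consensus (- mirror_laplacian G) -> structurally_balanced G.
Proof.
move=> n_gt0 Gc consensus; apply: contrapT => Gu.
pose i := Ordinal n_gt0.
have [s [s1 lim_s]] := consensus (delta_mx i ord0).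
(* Consensus and stability both quantify over trajectories, so the contradiction needs an actual
   one. *)
have [x traj x0E] := trajectory_exists (- mirror_laplacian G) (delta_mx i ord0).
have x_s := lim_s x traj x0E i.
have x_0 := unbalanced_state_stability Gc Gu traj x0E i.
have := cvg_unique (@Rhausdorff R) x_s x_0.
(* The consensus limit of coordinate [i] is s_i s_i / n = 1 / n, whereas stability gives 0. *)
rewrite (bigD1 i)//= big1 => [|j ji]; last by rewrite mxE (negbTE ji) mulr0.
rewrite mxE !eqxx mulr1 addr0 mulrAC sign_vectorM// mul1r => /(_ _)/eqP.
by rewrite invr_eq0 pnatr_eq0 gtn_eqF.
Qed.

Theorem theorem1 (R : realType) (n : nat) (n_gt0 : (0 < n)%N)
    (G : signed_digraph R n) (G_connected : strongly_connected G) :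
  (signed_average_consensus (- mirror_laplacian G)
     <-> structurally_balanced G) /\
  (state_stability (- mirror_laplacian G)
     <-> structurally_unbalanced G).
Proof.
split; split.
- exact: signed_average_consensus_balanced.
- exact: balanced_signed_average_consensus.
- exact: state_stability_unbalanced.
- exact: unbalanced_state_stability.
Qed.
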